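(* In the High-Temperature-Limit (HTL) model in Lagrangian coordinates, the characteristic speeds are $$\lambda_\pm=\pm\frac pa\sqrt{\frac{5}{3T(1+\alpha)}},\qquad\lambda_0=0.$$ Denoting by $R_\pm$ the eigenvectors corresponding to $\lambda_\pm$, normalized as in the context, one has $R_\pm\nabla\log|\lambda_\pm|=\pm\frac{4}{5p}$, and hence both $\lambda_\pm$ are genuinely nonlinear. The eigenvalue $\lambda_0$ is linearly degenerate.
   Context: Fix positive constants $a$ and $\kappa$. The HTL model is the gas dynamics system in Lagrangian coordinates $v_t-u_\xi=0$, $u_t+p_\xi=0$, $(e+\frac12u^2)_t+(pu)_\xi=0$, with state variables $p>0$, $u\in\mathbb R$, $T>0$, degree of ionization $\alpha=\left(1+\kappa pT^{-5/2}\right)^{-1/2}\in(0,1)$, specific volume $v=a^2(1+\alpha)T/p$ and internal energy $e=\frac32a^2(1+\alpha)T$. The dimensionless entropy $\eta$, with $a^2T\,d\eta=de+p\,dv$, is $\eta=-2\log\frac{1-\alpha}{\alpha}+\frac52\alpha+\text{const}$. In the variables $(p,u,T)$ the eigenvectors are normalized as $R_\pm=\left(\pm1,\frac1\lambda,\mp\frac{\eta_p}{\eta_T}\right)^T$, $R_0=(0,0,1)^T$, with $\lambda=\lambda_+$ and $\eta_p,\eta_T$ the partial derivatives of $\eta(p,T)$. An eigenvalue $\lambda_j$ is genuinely nonlinear if $R_j\nabla\lambda_j\ne0$ at every state, linearly degenerate if $R_j\nabla\lambda_j\equiv0$. *)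

(* Defs.v *)
From HB Require Import structures.
From mathcomp Require Import all_boot all_order all_algebra.
From mathcomp Require Import all_classical all_reals all_analysis.

Set Implicit Arguments.
Unset Strict Implicit.
Unset Printing Implicit Defensive.

Import Order.TTheory GRing.Theory Num.Theory.
Import numFieldNormedType.Exports.

Local Open Scope classical_set_scope.
Local Open Scope ring_scope.

(* A system (F0 U)_t + (F1 U)_xi = 0.  Vectors are rows and the library's
   Jacobian acts on the right ('d F U r = r *m 'J F U), so the condition below
   is the usual  DF1(U) r = l DF0(U) r. *)
Definition is_eigenvector (R : realType) (n : nat) (F0 F1 : 'rV[R]_n -> 'rV[R]_n)
    (U : 'rV[R]_n) (l : R) (r : 'rV[R]_n) : Prop :=
  r != 0 /\ r *m 'J F1 U = l *: (r *m 'J F0 U).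

Definition characteristic_speed (R : realType) (n : nat)
    (F0 F1 : 'rV[R]_n -> 'rV[R]_n) (U : 'rV[R]_n) (l : R) : Prop :=
  exists r : 'rV[R]_n, is_eigenvector F0 F1 U l r.

(* The product of r with the gradient of f at U.  Where f is not differentiable
   the library sets 'd f U = 0, so a nonzero value entails differentiability. *)
Definition along_grad (R : realType) (n : nat) (r : 'rV[R]_n)
    (f : 'rV[R]_n -> R) (U : 'rV[R]_n) : R := 'd f U r.

Definition genuinely_nonlinear (R : realType) (n : nat) (D : set 'rV[R]_n)
    (l : 'rV[R]_n -> R) (r : 'rV[R]_n -> 'rV[R]_n) : Prop :=
  forall U, D U -> along_grad (r U) l U != 0.

Definition linearly_degenerate (R : realType) (n : nat) (D : set 'rV[R]_n)
    (l : 'rV[R]_n -> R) (r : 'rV[R]_n -> 'rV[R]_n) : Prop :=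
  forall U, D U -> along_grad (r U) l U = 0.

Definition row3 (R : realType) (x y z : R) : 'rV[R]_3 :=
  \row_(j < 3) [:: x; y; z]`_j.

(* The coordinates of a state are U = (p, u, T). *)
Definition pr (R : realType) (U : 'rV[R]_3) : R := U 0 0.
Definition vel (R : realType) (U : 'rV[R]_3) : R := U 0 1.
Definition temp (R : realType) (U : 'rV[R]_3) : R := U 0 2.

Definition states (R : realType) : set 'rV[R]_3 :=
  [set U | 0 < pr U /\ 0 < temp U].

Definition alpha (R : realType) (kappa p T : R) : R :=
  (1 + kappa * p * T `^ (- (5 / 2))) `^ (- (1 / 2)).

Definition specific_volume (R : realType) (a kappa p T : R) : R :=
  a ^+ 2 * (1 + alpha kappa p T) * T / p.

Definition internal_energy (R : realType) (a kappa p T : R) : R :=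
  3 / 2 * a ^+ 2 * (1 + alpha kappa p T) * T.

Definition eta (R : realType) (kappa c p T : R) : R :=
  - 2 * ln ((1 - alpha kappa p T) / alpha kappa p T)
  + 5 / 2 * alpha kappa p T + c.

Definition eta_p (R : realType) (kappa c p T : R) : R :=
  derive1 (fun x => eta kappa c x T) p.

Definition eta_T (R : realType) (kappa c p T : R) : R :=
  derive1 (fun x => eta kappa c p x) T.

Definition density (R : realType) (a kappa : R) (U : 'rV[R]_3) : 'rV[R]_3 :=
  row3 (specific_volume a kappa (pr U) (temp U))
       (vel U)
       (internal_energy a kappa (pr U) (temp U) + 1 / 2 * vel U ^+ 2).

Definition flux (R : realType) (U : 'rV[R]_3) : 'rV[R]_3 :=
  row3 (- vel U) (pr U) (pr U * vel U).

Definition lambda_plus (R : realType) (a kappa : R) (U : 'rV[R]_3) : R :=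
  pr U / a *
  Num.sqrt (5 / (3 * temp U * (1 + alpha kappa (pr U) (temp U)))).

Definition lambda_minus (R : realType) (a kappa : R) (U : 'rV[R]_3) : R :=
  - lambda_plus a kappa U.

Definition lambda_0 (R : realType) (U : 'rV[R]_3) : R := 0.

Definition R_plus (R : realType) (a kappa c : R) (U : 'rV[R]_3) : 'rV[R]_3 :=
  row3 1 (lambda_plus a kappa U)^-1
    (- (eta_p kappa c (pr U) (temp U) / eta_T kappa c (pr U) (temp U))).

Definition R_minus (R : realType) (a kappa c : R) (U : 'rV[R]_3) : 'rV[R]_3 :=
  row3 (- 1) (lambda_plus a kappa U)^-1
    (eta_p kappa c (pr U) (temp U) / eta_T kappa c (pr U) (temp U)).

Definition R_0 (R : realType) (U : 'rV[R]_3) : 'rV[R]_3 := row3 0 0 1.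

(* Main.v *)
Require Import Defs.
From HB Require Import structures.
From mathcomp Require Import all_boot all_order all_algebra.
From mathcomp Require Import all_classical all_reals all_analysis.
From mathcomp Require Import ring lra.

Import Order.TTheory GRing.Theory Num.Theory.
Import numFieldNormedType.Exports.

Local Open Scope classical_set_scope.
Local Open Scope ring_scope.

(** The degree of ionization, and with it the entropy, is a function of the
    single quantity [y = kappa p T^(-5/2)], strictly decreasing with nonzero
    derivative.  Hence the slope [- eta_p / eta_T] is that of the level curves
    of [y], namely [2 T / (5 p)] ([isentropic_slope]), and [alpha] is constant
    to first order along every direction [r] with [dT = 2 T / (5 p) dp]; these
    are called [isentropic].

    Since [dE + p dV] is [a^2 T] times the entropy differential, it vanishes
    exactly on isentropic directions ([gibbs], [isentropicP]).  On them [alpha]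
    is frozen and the derivative of the specific volume with respect to [p] is
    [- 1 / s], where [s] is [sound_speed_sqr] ([dvolume_isentropic]): the usual
    formula for the sound speed in Lagrangian coordinates.

    An eigenvector [r = (dp, du, dT)] for [l] satisfies [- du = l dV],
    [dp = l du] and [p du = l dE] ([eigenvectorE]).  If [l] is nonzero, the
    first and third equations give [dE + p dV = 0], so [r] is isentropic, and
    the first two give [- dp = l^2 dV], so [l^2 = s]
    ([nonzero_speed_sqr]); conversely isentropic directions with [dp = l du] and
    [l^2 = s] are eigenvectors ([sound_eigenvector]).  The value [l = 0] forces
    [dp = du = 0] and leaves [R_0].

    Finally [log lambda = log p - (log T + log (1 + alpha)) / 2 + const], and
    along an isentropic direction [alpha] contributes nothing, so the
    derivative is [dp / p - dp / (5 p) = 4 dp / (5 p)]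
    ([dlog_lambda_isentropic]). *)

(** * Rules of differentiation *)

Lemma is_diff_comp1 {R : realType} {V : normedModType R} {g : R -> R} {f : V -> R}
    {df : V -> R} {x : V} {d : R} :
  is_diff x f df -> is_derive (f x) 1 g d ->
  is_diff x (fun y => g (f y)) (fun r => d * df r).
Proof.
move=> fdf [/derivable1_diffP gdiff gd].
have gdg : is_diff (f x) g (fun h => d * h).
  apply: DiffDef => //; apply/funext => h.
  by rewrite diff1E // derive1E gd /= [LHS]mulrC.
exact: (is_diff_comp fdf gdg).
Qed.

Lemma is_diff_mul {R : realType} {V : normedModType R} {f g df dg : V -> R} {x : V} :
  is_diff x f df -> is_diff x g dg ->
  is_diff x (fun y => f y * g y) (fun r => f x * dg r + g x * df r).
Proof. by move=> fdf gdg; exact: (is_diffM fdf gdg). Qed.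

Lemma is_diff_add {R : realType} {V : normedModType R} {f g df dg : V -> R} {x : V} :
  is_diff x f df -> is_diff x g dg ->
  is_diff x (fun y => f y + g y) (fun r => df r + dg r).
Proof. by move=> fdf gdg; exact: (is_diffD fdf gdg). Qed.

Lemma is_diff_coord {R : realType} {n} (i : 'I_n) (U : 'rV[R]_n) :
  is_diff U (fun V => V 0 i) (fun r => r 0 i).
Proof.
have lin : linear (fun V : 'rV[R]_n => V 0 i : R^o) by move=> k V W; rewrite !mxE.
pose coordM := GRing.isLinear.Build _ _ _ _ _ lin.
pose coordL : {linear _ -> _} := HB.pack (fun V : 'rV[R]_n => V 0 i) coordM.
apply: DiffDef; first exact: differentiable_coord.
rewrite (_ : (fun V : 'rV[R]_n => V 0 i) = coordL) // diff_lin //.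
exact: coord_continuous.
Qed.

Lemma is_diff_row3 {R : realType} {V : normedModType R} {f g h df dg dh : V -> R} {x : V} :
  is_diff x f df -> is_diff x g dg -> is_diff x h dh ->
  is_diff x (fun y => row3 (f y) (g y) (h y)) (fun r => row3 (df r) (dg r) (dh r)).
Proof.
have row3E a b c :
    row3 a b c = a *: row3 1 0 0 + b *: row3 0 1 0 + c *: row3 0 0 1 :> 'rV[R]_3.
  by apply/rowP => j; rewrite !mxE; case: j => [[|[|[|//]]]] //= _; ring.
move=> fdf gdg hdh.
under eq_fun do rewrite row3E.
apply: (@is_diff_eq _ _ _ _ _ _ _ (is_diffD (is_diffD
  (is_diff_comp fdf (is_diff_scalel _ _)) (is_diff_comp gdg (is_diff_scalel _ _)))
  (is_diff_comp hdh (is_diff_scalel _ _)))).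
by apply/funext => r; rewrite [RHS]row3E.
Qed.

Lemma is_derive1_inv {R : realType} {x : R} : x != 0 ->
  is_derive x 1 (fun y : R => y^-1) (- x ^- 2).
Proof.
move=> x0; have := is_deriveV x0 (is_derive_id x 1).
by rewrite /GRing.scale /= mulr1.
Qed.

Lemma is_derive1_ln_norm {R : realType} {x : R} : 0 < x ->
  is_derive x 1 (fun y : R => ln `|y|) x^-1.
Proof.
move=> x0; apply: near_eq_is_derive (is_derive1_ln x0).
by near=> y; rewrite gtr0_norm //; near: y; exact: lt_nbhsr.
Unshelve. all: by end_near. Qed.

Lemma is_derive1_comp_mul {R : realType} {g f : R -> R} {x d df : R} :
  is_derive x 1 f df -> is_derive (f x) 1 g d -> is_derive x 1 (fun y => g (f y)) (d * df).
Proof. by move=> fd gd; exact: is_derive1_comp. Qed.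

(** * Ionization and entropy as functions of one variable *)

Section HTL.
Context {R : realType}.
Set Implicit Arguments.
Unset Strict Implicit.
Implicit Types (U : 'rV[R]_3) (a kappa c p T y : R).

(** By Saha's equation this is [(1 - alpha^2) / alpha^2]; [alpha] and [eta]
    depend on the state through it alone. *)
Definition saha_ratio kappa p T : R := kappa * p * T `^ (- (5 / 2)).
Definition ionization (y : R) : R := (1 + y) `^ (- (1 / 2)).
Definition entropy c (y : R) : R :=
  - 2 * ln ((1 - ionization y) / ionization y) + 5 / 2 * ionization y + c.

Lemma saha_ratio_gt0 kappa p T : 0 < kappa -> 0 < p -> 0 < T ->
  0 < saha_ratio kappa p T.
Proof. by move=> k0 p0 T0; rewrite !mulr_gt0 // powR_gt0. Qed.

Lemma ionization_gt0 y : 0 < y -> 0 < ionization y.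
Proof. by move=> y0; rewrite powR_gt0 // addr_gt0. Qed.

Lemma ionization_lt1 y : 0 < y -> ionization y < 1.
Proof.
move=> y0; rewrite /ionization powRN invf_lt1 ?powR_gt0 ?addr_gt0 //.
have : (1 : R) `^ (1 / 2) < (1 + y) `^ (1 / 2).
  by rewrite gt0_ltr_powR ?divr_gt0 ?nnegrE ?ltrDl // addr_ge0 // ltW.
by rewrite powR1.
Qed.

Definition dionization (y : R) : R := - (1 / 2) * (1 + y) `^ (- (1 / 2) - 1).

Lemma is_derive_ionization y : 0 < y -> is_derive y 1 ionization (dionization y).
Proof.
move=> y0; have y1 : 0 < 1 + y by rewrite addr_gt0.
have := is_derive1_comp_mul (is_deriveD (is_derive_cst (1 : R) y 1) (is_derive_id y 1))
   (is_derive1_powR (- (1 / 2)) y1).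
by rewrite add0r mulr1.
Qed.

Lemma dionization_lt0 y : 0 < y -> dionization y < 0.
Proof. by move=> y0; rewrite nmulr_rlt0 ?powR_gt0 ?addr_gt0 //; lra. Qed.

Lemma is_derive_entropy c y : 0 < y ->
  is_derive y 1 (entropy c)
    ((2 / (ionization y * (1 - ionization y)) + 5 / 2) * dionization y).
Proof.
move=> y0; have dA := is_derive_ionization y0.
have A0 := ionization_gt0 y0; have A1 := ionization_lt1 y0.
have dodds : is_derive (ionization y) 1 (fun A : R => (1 - A) / A)
   (- (ionization y) ^- 2).
  have := is_deriveM (is_deriveB (is_derive_cst (1 : R) (ionization y) 1)
    (is_derive_id (ionization y) 1)) (is_derive1_inv (lt0r_neq0 A0)).
  move=> /is_derive_eq; apply; rewrite /GRing.scale /= !fctE /=; field.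
  exact: lt0r_neq0.
have odds_gt0 : 0 < (1 - ionization y) / ionization y by rewrite divr_gt0 // subr_gt0.
have dln := is_derive1_comp_mul dodds (is_derive1_ln odds_gt0).
have := is_derive1_comp_mul dA (is_deriveD (is_deriveD (is_deriveZ (-2) dln)
  (is_deriveZ (5 / 2) (is_derive_id (ionization y) 1)))
  (is_derive_cst (c : R) (ionization y) 1)).
move=> /is_derive_eq; apply; rewrite /GRing.scale /=; field.
by rewrite ?lt0r_neq0 ?subr_gt0.
Qed.

Lemma dentropy_neq0 y : 0 < y ->
 (2 / (ionization y * (1 - ionization y)) + 5 / 2) * dionization y != 0.
Proof.
move=> y0; rewrite mulf_neq0 ?(ltr0_neq0 (dionization_lt0 y0)) // lt0r_neq0 //.
by rewrite addr_gt0 ?divr_gt0 ?mulr_gt0 ?subr_gt0 ?ionization_gt0 ?ionization_lt1.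
Qed.

(** Written as multiples of the function itself, the logarithmic partial
    derivatives [1 / p] and [- 5 / (2 T)] are visible. *)
Lemma is_derive_saha_p kappa p T : p != 0 ->
  is_derive p 1 (fun x => saha_ratio kappa x T) (saha_ratio kappa p T / p).
Proof.
move=> p0.
have := is_deriveZ (kappa * T `^ (- (5 / 2))) (is_derive_id p 1).
rewrite (_ : _ \*: _ = fun x => saha_ratio kappa x T); last first.
  by apply/funext => x /=; rewrite /saha_ratio mulrAC.
by move=> /is_derive_eq; apply; rewrite /GRing.scale /= /saha_ratio; field.
Qed.

Lemma is_derive_powR_div (b x : R) : 0 < x ->
  is_derive x 1 (fun y => y `^ b) (b * x `^ b / x).
Proof.
move=> x0; have := is_derive1_powR b x0.
by rewrite powRB ?lt0r_neq0 ?implybT // powRr1 ?ltW // mulrA.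
Qed.

Lemma is_derive_saha_T kappa p T : 0 < T ->
  is_derive T 1 (fun x => saha_ratio kappa p x) (- (5 / 2) * (saha_ratio kappa p T / T)).
Proof.
move=> T0.
have := is_deriveZ (kappa * p) (is_derive_powR_div (- (5 / 2)) T0).
move=> /is_derive_eq; apply; rewrite /GRing.scale /= /saha_ratio.
by field; rewrite ?lt0r_neq0.
Qed.

(** The derivative of [entropy c] at [y] is a factor of both partial derivatives
    of [eta] and is nonzero, so the ratio is that of the partial derivatives of
    [y = kappa p T^(-5/2)]. *)
Lemma isentropic_slope kappa c p T : 0 < kappa -> 0 < p -> 0 < T ->
  - (eta_p kappa c p T / eta_T kappa c p T) = 2 * T / (5 * p).
Proof.
move=> k0 p0 T0; have y0 := saha_ratio_gt0 k0 p0 T0.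
have [_ dp] := is_derive1_comp_mul (is_derive_saha_p kappa T (lt0r_neq0 p0))
  (is_derive_entropy c y0).
have [_ dT] := is_derive1_comp_mul (is_derive_saha_T kappa p T0) (is_derive_entropy c y0).
have -> : eta_p kappa c p T = _ := etrans (derive1E _ _) dp.
have -> : eta_T kappa c p T = _ := etrans (derive1E _ _) dT.
have := dentropy_neq0 y0.
move: (_ * dionization _) => E E0; have y_neq0 := lt0r_neq0 y0.
have p_neq0 := lt0r_neq0 p0; have T_neq0 := lt0r_neq0 T0.
field.
by rewrite p_neq0 T_neq0 y_neq0 E0.
Qed.

(** * Differentials of the thermodynamic functions *)

(** This is [- y d(alpha)/dy], the rate of change of [alpha] per unit of
    [- log y]; the sign is chosen to make it positive. *)
Definition ionization_rate kappa U : R :=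
  let y := saha_ratio kappa (pr U) (temp U) in - (y * dionization y).

Lemma ionization_rate_gt0 kappa U : 0 < kappa -> states U -> 0 < ionization_rate kappa U.
Proof.
move=> k0 [p0 T0]; have y0 := saha_ratio_gt0 k0 p0 T0.
by rewrite oppr_gt0 pmulr_rlt0 ?dionization_lt0.
Qed.

Lemma alpha_gt0 kappa U : 0 < kappa -> states U -> 0 < alpha kappa (pr U) (temp U).
Proof. by move=> k0 [p0 T0]; exact: ionization_gt0 (saha_ratio_gt0 k0 p0 T0). Qed.

Definition dalpha kappa U (r : 'rV[R]_3) : R :=
  ionization_rate kappa U * (5 / 2 * (temp r / temp U) - pr r / pr U).

Lemma is_diff_pr U : is_diff U (@pr R) (@pr R).
Proof. exact: is_diff_coord. Qed.

Lemma is_diff_vel U : is_diff U (@vel R) (@vel R).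
Proof. exact: is_diff_coord. Qed.

Lemma is_diff_temp U : is_diff U (@temp R) (@temp R).
Proof. exact: is_diff_coord. Qed.

Lemma is_diff_const (k : R) U : is_diff U (fun=> k) (fun=> 0).
Proof. exact: is_diff_cst. Qed.

Lemma is_diff_alpha kappa U : 0 < kappa -> states U ->
  is_diff U (fun V => alpha kappa (pr V) (temp V)) (dalpha kappa U).
Proof.
move=> k0 [p0 T0]; have y0 := saha_ratio_gt0 k0 p0 T0.
have dpow := is_diff_comp1 (is_diff_temp U) (is_derive_powR_div (- (5 / 2)) T0).
have dsaha := is_diff_mul (is_diff_mul (is_diff_const kappa U) (is_diff_pr U)) dpow.
apply: (is_diff_eq (is_diff_comp1 dsaha (is_derive_ionization y0))).
apply/funext => r; rewrite /dalpha /ionization_rate /saha_ratio.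
by field; rewrite !lt0r_neq0.
Qed.

Definition dvolume a kappa U (r : 'rV[R]_3) : R :=
  a ^+ 2 * temp U / pr U *
  (dalpha kappa U r + (1 + alpha kappa (pr U) (temp U)) * (temp r / temp U - pr r / pr U)).

Definition denergy a kappa U (r : 'rV[R]_3) : R :=
  3 / 2 * a ^+ 2 * temp U *
  (dalpha kappa U r + (1 + alpha kappa (pr U) (temp U)) * (temp r / temp U)).

Lemma is_diff_volume a kappa U : 0 < kappa -> states U ->
  is_diff U (fun V => specific_volume a kappa (pr V) (temp V)) (dvolume a kappa U).
Proof.
move=> k0 sU; have [p0 T0] := sU; have p_neq0 := lt0r_neq0 p0.
have dN := is_diff_add (is_diff_const 1 U) (is_diff_alpha k0 sU).
have dNT := is_diff_mul (is_diff_mul (is_diff_const (a ^+ 2) U) dN) (is_diff_temp U).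
apply: (is_diff_eq (is_diff_mul dNT (is_diff_comp1 (is_diff_pr U) (is_derive1_inv p_neq0)))).
apply/funext => r; rewrite /dvolume; field.
by rewrite p_neq0 lt0r_neq0.
Qed.

Lemma is_diff_energy a kappa U : 0 < kappa -> states U ->
  is_diff U (fun V => internal_energy a kappa (pr V) (temp V)) (denergy a kappa U).
Proof.
move=> k0 sU; have [p0 T0] := sU.
have dN := is_diff_add (is_diff_const 1 U) (is_diff_alpha k0 sU).
apply: (is_diff_eq (is_diff_mul (is_diff_mul (is_diff_const (3 / 2 * a ^+ 2) U) dN)
  (is_diff_temp U))).
apply/funext => r; rewrite /denergy; field.
by rewrite lt0r_neq0.
Qed.

Lemma mul_jacobian {n m} (F dF : _ -> _) (U : 'rV[R]_n) (r : 'rV[R]_n) :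
  is_diff U (F : 'rV[R]_n -> 'rV[R]_m) dF -> r *m 'J F U = dF r.
Proof. by move=> [_ <-]; rewrite /jacobian mul_rV_lin1. Qed.

Lemma mul_jacobian_density a kappa U (r : 'rV[R]_3) : 0 < kappa -> states U ->
  r *m 'J (density a kappa) U =
  row3 (dvolume a kappa U r) (vel r) (denergy a kappa U r + vel U * vel r).
Proof.
move=> k0 sU; apply: (mul_jacobian (dF := fun r => _)).
have dkin := is_diff_mul (is_diff_const (1 / 2) U) (is_diff_mul (is_diff_vel U) (is_diff_vel U)).
apply: (is_diff_eq (is_diff_row3 (is_diff_volume a k0 sU) (is_diff_vel U)
  (is_diff_add (is_diff_energy a k0 sU) dkin))).
by apply/funext => s; congr row3; field.
Qed.

Lemma mul_jacobian_flux U (r : 'rV[R]_3) :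
  r *m 'J (@flux R) U = row3 (- vel r) (pr r) (pr U * vel r + vel U * pr r).
Proof.
apply: (mul_jacobian (dF := fun r => _)).
exact: (is_diff_row3 (is_diffN (is_diff_vel U)) (is_diff_pr U)
  (is_diff_mul (is_diff_pr U) (is_diff_vel U))).
Qed.

(** * The eigenvalue problem *)

Lemma row3K (r : 'rV[R]_3) : row3 (pr r) (vel r) (temp r) = r.
Proof.
by apply/rowP => j; rewrite mxE; case: j => [[|[|[|//]]]] //= i; congr (r 0 _); apply: val_inj.
Qed.

Lemma row3P (x y z x' y' z' : R) :
  row3 x y z = row3 x' y' z' <-> [/\ x = x', y = y' & z = z'].
Proof.
split=> [/rowP e|[-> -> ->] //].
by have := (e 0, e 1, e 2); rewrite !mxE /= => -[[-> ->] ->].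
Qed.

Lemma row3_neq0 (x y z : R) : (row3 x y z != 0) = [|| x != 0, y != 0 | z != 0].
Proof.
rewrite -!negb_and; congr (~~ _).
have -> : (0 : 'rV[R]_3) = row3 0 0 0.
  by apply/rowP => j; rewrite !mxE; case: j => [[|[|[|//]]]].
by apply/eqP/and3P => [/row3P[-> -> ->]|[/eqP-> /eqP-> /eqP->]].
Qed.

(** The kinetic part [u du] of the energy balance cancels against the term
    [u dp] of the flux, by the momentum equation [dp = l du]. *)
Lemma eigenvectorE a kappa U l (r : 'rV[R]_3) : 0 < kappa -> states U ->
  is_eigenvector (density a kappa) (@flux R) U l r <->
  [/\ r != 0, - vel r = l * dvolume a kappa U r, pr r = l * vel r &
      pr U * vel r = l * denergy a kappa U r].
Proof.
move=> k0 sU; rewrite /is_eigenvector.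
have -> : (r *m 'J (@flux R) U = l *: (r *m 'J (density a kappa) U)) =
  (row3 (- vel r) (pr r) (pr U * vel r + vel U * pr r) =
   l *: row3 (dvolume a kappa U r) (vel r) (denergy a kappa U r + vel U * vel r)).
  by congr (_ = l *: _); [exact: mul_jacobian_flux | exact: mul_jacobian_density].
have -> x y z : l *: row3 x y z = row3 (l * x) (l * y) (l * z).
  by apply/rowP => j; rewrite !mxE; case: j => [[|[|[|//]]]].
split=> [[r0 /row3P[e1 e2 e3]]|[r0 e1 e2 e3]]; split=> //.
  by apply: (addIr (vel U * pr r)); rewrite e3 [in RHS]e2; ring.
by apply/row3P; split=> //; rewrite e3 [in LHS]e2; ring.
Qed.

(** This is [- dp / dV] at constant entropy; see [dvolume_isentropic]. *)
Definition sound_speed_sqr a kappa U : R :=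
  5 * pr U ^+ 2 / (3 * a ^+ 2 * temp U * (1 + alpha kappa (pr U) (temp U))).

Lemma lambda_plus_gt0 a kappa U : 0 < a -> 0 < kappa -> states U ->
  0 < lambda_plus a kappa U.
Proof.
move=> a0 k0 sU; have [p0 T0] := sU; have A0 := alpha_gt0 k0 sU.
by rewrite mulr_gt0 ?divr_gt0 // sqrtr_gt0 divr_gt0 // !mulr_gt0 // addr_gt0.
Qed.

Lemma lambda_plus_sqr a kappa U : 0 < a -> 0 < kappa -> states U ->
  lambda_plus a kappa U ^+ 2 = sound_speed_sqr a kappa U.
Proof.
move=> a0 k0 sU; have [p0 T0] := sU; have A0 := alpha_gt0 k0 sU.
have N0 : 0 < 1 + alpha kappa (pr U) (temp U) by rewrite addr_gt0.
rewrite exprMn sqr_sqrtr; last by rewrite divr_ge0 // ltW // !mulr_gt0.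
by rewrite /sound_speed_sqr; field; rewrite !lt0r_neq0.
Qed.

(** By [isentropic_slope] these are the directions of the kernel of [d eta];
    this form avoids the partial derivatives of the entropy. *)
Definition isentropic U (r : 'rV[R]_3) : Prop :=
  temp r = pr r * (2 * temp U / (5 * pr U)).

(** Up to the positive coefficient this is the differential of [- log y], as
    it must be since [dE + p dV] is proportional to that of the entropy. *)
Lemma gibbs a kappa U (r : 'rV[R]_3) : states U ->
  denergy a kappa U r + pr U * dvolume a kappa U r =
  a ^+ 2 * temp U *
  (1 + alpha kappa (pr U) (temp U) + 5 / 2 * ionization_rate kappa U) *
  (5 / 2 * (temp r / temp U) - pr r / pr U).
Proof.
move=> [p0 T0]; rewrite /denergy /dvolume /dalpha; field.
by rewrite !lt0r_neq0.
Qed.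

(** The coefficient in [gibbs] is positive, so only its last factor can vanish. *)
Lemma isentropicP a kappa U (r : 'rV[R]_3) : 0 < a -> 0 < kappa -> states U ->
  isentropic U r <-> denergy a kappa U r = - (pr U * dvolume a kappa U r).
Proof.
move=> a0 k0 sU; have [p0 T0] := sU.
have p_neq0 := lt0r_neq0 p0; have T_neq0 := lt0r_neq0 T0.
have C0 : a ^+ 2 * temp U *
    (1 + alpha kappa (pr U) (temp U) + 5 / 2 * ionization_rate kappa U) != 0.
  by rewrite lt0r_neq0 // !mulr_gt0 ?exprn_gt0 //
    !addr_gt0 ?mulr_gt0 ?alpha_gt0 ?ionization_rate_gt0.
rewrite /isentropic; split=> [eT | /eqP].
  apply/eqP; rewrite -addr_eq0 gibbs // eT mulf_eq0; apply/orP; right.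
  by apply/eqP; field; rewrite p_neq0 T_neq0.
rewrite -addr_eq0 gibbs // mulf_eq0 (negPf C0) subr_eq0 /= => /eqP eT.
have -> : temp r = 2 / 5 * temp U * (5 / 2 * (temp r / temp U)) by field.
by rewrite eT; field.
Qed.

Lemma dalpha_isentropic kappa U (r : 'rV[R]_3) : states U -> isentropic U r ->
  dalpha kappa U r = 0.
Proof.
by move=> [p0 T0] eT; rewrite /dalpha eT; field; rewrite !lt0r_neq0.
Qed.

Lemma sound_speed_sqr_gt0 a kappa U : 0 < a -> 0 < kappa -> states U ->
  0 < sound_speed_sqr a kappa U.
Proof.
move=> a0 k0 sU; have [p0 T0] := sU.
by rewrite divr_gt0 ?mulr_gt0 ?exprn_gt0 ?addr_gt0 ?alpha_gt0.
Qed.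

Lemma dvolume_isentropic a kappa U (r : 'rV[R]_3) : 0 < a -> 0 < kappa -> states U ->
  isentropic U r -> sound_speed_sqr a kappa U * dvolume a kappa U r = - pr r.
Proof.
move=> a0 k0 sU er; have [p0 T0] := sU.
have N0 : 0 < 1 + alpha kappa (pr U) (temp U) by rewrite addr_gt0 ?alpha_gt0.
rewrite /sound_speed_sqr /dvolume dalpha_isentropic // er; field.
by rewrite !lt0r_neq0.
Qed.

(** Eliminating [du] shows that [r] is isentropic and that [- dp = l^2 dV]; the
    factor [dV] can be cancelled, since [dV = 0] would give [dp = du = 0] and
    then [dT = 0] by isentropy. *)
Lemma nonzero_speed_sqr a kappa U l : 0 < a -> 0 < kappa -> states U -> l != 0 ->
  characteristic_speed (density a kappa) (@flux R) U l ->
  l ^+ 2 = sound_speed_sqr a kappa U.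
Proof.
move=> a0 k0 sU l0 [r /(eigenvectorE _ _ _ k0 sU)[r0 e1 e2 e3]].
have er : isentropic U r.
  apply/(isentropicP r a0 k0 sU)/(mulfI l0); rewrite -e3 mulrN mulrCA -e1.
  by rewrite mulrN opprK.
have rp : - pr r = l ^+ 2 * dvolume a kappa U r.
  by rewrite e2 expr2 -mulrA -e1 mulrN.
have dv0 : dvolume a kappa U r != 0.
  apply: contraNneq r0 => dv0; have p0 : pr r = 0.
    by apply: oppr_inj; rewrite rp dv0 mulr0 oppr0.
  have v0 : vel r = 0 by apply: oppr_inj; rewrite e1 dv0 mulr0 oppr0.
  by rewrite -[r]row3K -[_ == _]negbK row3_neq0 er p0 v0 mul0r eqxx.
by apply: (mulIf dv0); rewrite -rp dvolume_isentropic.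
Qed.

Lemma sound_eigenvector a kappa U l s : 0 < a -> 0 < kappa -> states U ->
  s != 0 -> l ^+ 2 = sound_speed_sqr a kappa U ->
  is_eigenvector (density a kappa) (@flux R) U l
    (row3 s (s / l) (s * (2 * temp U / (5 * pr U)))).
Proof.
move=> a0 k0 sU s0 l2.
have l0 : l != 0 by rewrite -sqrf_eq0 l2 lt0r_neq0 ?sound_speed_sqr_gt0.
apply/(eigenvectorE _ _ _ k0 sU); set r := row3 _ _ _.
have rp : pr r = s by rewrite /pr mxE.
have ru : vel r = s / l by rewrite /vel mxE.
have er : isentropic U r by rewrite /isentropic rp /temp mxE.
have dv : l ^+ 2 * dvolume a kappa U r = - s by rewrite l2 dvolume_isentropic // rp.
have ldv : l * dvolume a kappa U r = - (s / l).
  by apply: (mulfI l0); rewrite mulrA -expr2 dv; field.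
split; first by rewrite row3_neq0 s0.
- by rewrite ru ldv.
- by rewrite rp ru mulrCA divff // mulr1.
- by rewrite (isentropicP r a0 k0 sU).1 // mulrN mulrCA ldv ru mulrN opprK.
Qed.

Lemma contact_eigenvector a kappa U : 0 < kappa -> states U ->
  is_eigenvector (density a kappa) (@flux R) U 0 (row3 0 0 1).
Proof.
move=> k0 sU; apply/(eigenvectorE _ _ _ k0 sU).
by split; rewrite ?row3_neq0 ?oner_neq0 ?orbT // /vel /pr !mxE /= ?mul0r ?oppr0 ?mulr0.
Qed.

(** * The derivative of the sound speed *)

Definition dlog_lambda kappa U (r : 'rV[R]_3) : R :=
  pr r / pr U - 1 / 2 * (temp r / temp U + dalpha kappa U r / (1 + alpha kappa (pr U) (temp U))).

Lemma is_diff_lambda a kappa U : 0 < a -> 0 < kappa -> states U ->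
  is_diff U (lambda_plus a kappa) (fun r => lambda_plus a kappa U * dlog_lambda kappa U r).
Proof.
move=> a0 k0 sU; have [p0 T0] := sU; have A0 := alpha_gt0 k0 sU.
have N0 : 0 < 1 + alpha kappa (pr U) (temp U) by rewrite addr_gt0.
have dN := is_diff_add (is_diff_const 1 U) (is_diff_alpha k0 sU).
have den0 : 0 < 3 * temp U * (1 + alpha kappa (pr U) (temp U)) by rewrite !mulr_gt0.
have dden := is_diff_mul (is_diff_mul (is_diff_const 3 U) (is_diff_temp U)) dN.
have dq := is_diff_mul (is_diff_const 5 U) (is_diff_comp1 dden (is_derive1_inv (lt0r_neq0 den0))).
have q0 : 0 < 5 / (3 * temp U * (1 + alpha kappa (pr U) (temp U))) by rewrite divr_gt0.
apply: (is_diff_eq (is_diff_mul (is_diff_mul (is_diff_pr U) (is_diff_const a^-1 U))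
  (is_diff_comp1 dq (is_derive1_sqrt q0)))).
apply/funext => r; rewrite /lambda_plus /dlog_lambda.
have sqrt0 : 0 < Num.sqrt (5 / (3 * temp U * (1 + alpha kappa (pr U) (temp U)))).
  by rewrite sqrtr_gt0.
have := sqr_sqrtr (ltW q0).
move: (Num.sqrt _) sqrt0 => q qgt0 q2.
(* With 1 / (2 q) = q / (2 q^2), the radical q is a common factor of both
   sides, whose square no longer occurs. *)
have -> : (2 * q)^-1 = q / (2 * (5 / (3 * temp U * (1 + alpha kappa (pr U) (temp U))))).
  by rewrite -q2; field; rewrite lt0r_neq0.
field.
by rewrite !lt0r_neq0.
Qed.

(** Only [p] and [T] contribute, [alpha] being stationary in an isentropic
    direction; [T] removes a fifth of the contribution of [p]. *)
Lemma dlog_lambda_isentropic kappa U (r : 'rV[R]_3) : states U -> isentropic U r ->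
  dlog_lambda kappa U r = pr r * (4 / (5 * pr U)).
Proof.
move=> sU er; have [p0 T0] := sU.
rewrite /dlog_lambda dalpha_isentropic // er mul0r addr0; field.
by rewrite !lt0r_neq0.
Qed.

End HTL.

Theorem lemma8p1 (R : realType) (a kappa c : R) (ha : 0 < a) (hkappa : 0 < kappa) :
  (forall U : 'rV[R]_3, states U ->
     [/\ (forall l : R,
            characteristic_speed (density a kappa) (@flux R) U l <->
            (l = lambda_plus a kappa U \/ l = lambda_minus a kappa U \/
             l = lambda_0 U)),
         is_eigenvector (density a kappa) (@flux R) U
           (lambda_plus a kappa U) (R_plus a kappa c U),
         is_eigenvector (density a kappa) (@flux R) U
           (lambda_minus a kappa U) (R_minus a kappa c U) &
         is_eigenvector (density a kappa) (@flux R) U (lambda_0 U) (R_0 U)]) /\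
  (forall U : 'rV[R]_3, states U ->
     along_grad (R_plus a kappa c U) (fun V => ln `|lambda_plus a kappa V|) U
       = 4 / (5 * pr U) /\
     along_grad (R_minus a kappa c U) (fun V => ln `|lambda_minus a kappa V|) U
       = - (4 / (5 * pr U))) /\
  genuinely_nonlinear (@states R) (lambda_plus a kappa) (R_plus a kappa c) /\
  genuinely_nonlinear (@states R) (lambda_minus a kappa) (R_minus a kappa c) /\
  linearly_degenerate (@states R) (@lambda_0 R) (@R_0 R).
Proof.
have R_plusE U : states U -> R_plus a kappa c U =
    row3 1 (1 / lambda_plus a kappa U) (1 * (2 * temp U / (5 * pr U))).
  by move=> [p0 T0]; rewrite /R_plus isentropic_slope // div1r mul1r.
have R_minusE U : states U -> R_minus a kappa c U =
    row3 (- 1) (- 1 / lambda_minus a kappa U) (- 1 * (2 * temp U / (5 * pr U))).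
  move=> [p0 T0]; congr row3; first by rewrite invrN mulrNN mul1r.
  by rewrite -(isentropic_slope c hkappa p0 T0) mulN1r opprK.
have ep U : states U -> is_eigenvector (density a kappa) (@flux R) U
    (lambda_plus a kappa U) (R_plus a kappa c U).
  move=> sU; rewrite R_plusE //; apply: sound_eigenvector => //; exact: lambda_plus_sqr.
have em U : states U -> is_eigenvector (density a kappa) (@flux R) U
    (lambda_minus a kappa U) (R_minus a kappa c U).
  move=> sU; rewrite R_minusE //; apply: sound_eigenvector => //.
  by rewrite /lambda_minus sqrrN lambda_plus_sqr.
have e0 U : states U -> is_eigenvector (density a kappa) (@flux R) U (lambda_0 U) (R_0 U).
  by move=> sU; exact: contact_eigenvector.
have rpp U : states U -> isentropic U (R_plus a kappa c U) /\ pr (R_plus a kappa c U) = 1.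
  by move=> sU; rewrite R_plusE // /isentropic /pr /temp !mxE.
have rpm U : states U -> isentropic U (R_minus a kappa c U) /\ pr (R_minus a kappa c U) = -1.
  by move=> sU; rewrite R_minusE // /isentropic /pr /temp !mxE.
have dln U : states U -> is_diff U (fun V => ln `|lambda_plus a kappa V|) (dlog_lambda kappa U).
  move=> sU; have l0 := lambda_plus_gt0 ha hkappa sU.
  apply: (is_diff_eq (is_diff_comp1 (is_diff_lambda ha hkappa sU) (is_derive1_ln_norm l0))).
  by apply/funext => r; rewrite mulKf // lt0r_neq0.
have gp U : states U -> 4 / (5 * pr U) != 0.
  by move=> [p0 _]; rewrite lt0r_neq0 // divr_gt0 // mulr_gt0.
split; [|split; [|split; [|split]]].
- move=> U sU; split; [| exact: ep | exact: em | exact: e0].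
  move=> l; split; last by case=> [->|[->|->]]; eexists; [exact: ep | exact: em | exact: e0].
  have [->|l0] := eqVneq l 0; first by right; right.
  move=> /(nonzero_speed_sqr ha hkappa sU l0)/eqP.
  rewrite -lambda_plus_sqr // eqf_sqr => /orP[/eqP->|/eqP->]; [by left | by right; left].
- move=> U sU; have [er rp] := rpp U sU; have [er' rp'] := rpm U sU.
  have [_ dE] := dln U sU; rewrite /along_grad.
  have -> : (fun V => ln `|lambda_minus a kappa V|) = (fun V => ln `|lambda_plus a kappa V|).
    by apply/funext => V; rewrite /lambda_minus normrN.
  by rewrite dE !dlog_lambda_isentropic // rp rp' mul1r mulN1r.
- move=> U sU; have [er rp] := rpp U sU; have [_ dE] := is_diff_lambda ha hkappa sU.
  rewrite /along_grad dE dlog_lambda_isentropic // rp mul1r.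
  by rewrite mulf_neq0 ?gp // lt0r_neq0 // lambda_plus_gt0.
- move=> U sU; have [er rp] := rpm U sU.
  have [_ dE] : is_diff U (lambda_minus a kappa)
      (fun r => - (lambda_plus a kappa U * dlog_lambda kappa U r)).
    exact: is_diffN (is_diff_lambda ha hkappa sU).
  rewrite /along_grad dE dlog_lambda_isentropic // rp mulN1r mulrN opprK.
  by rewrite mulf_neq0 ?gp // lt0r_neq0 // lambda_plus_gt0.
- by move=> U _; rewrite /along_grad [X in X _ = _]diff_cst.
Qed.
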